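(* (i) For any permutation $\delta=(\delta_1,\dots,\delta_n)$ of $[n]$, the inequality $$w\ge\sum_{j=1}^n(\eta^\delta_{\delta_j}+b_{\delta_j})x_{\delta_j}\qquad(\mathrm{LEPI'})$$ is facet-defining for $\operatorname{conv}(X)$ and is stronger than the inequality $$w\ge\sum_{j=1}^n\big(f(a(\delta(j)))-f(a(\delta(j-1)))+b_{\delta_j}\big)x_{\delta_j}\qquad(\mathrm{EPI'}),$$ that is, each coefficient $\eta^\delta_{\delta_j}+b_{\delta_j}$ is at least $f(a(\delta(j)))-f(a(\delta(j-1)))+b_{\delta_j}$. (ii) All inequalities $(\mathrm{LEPI'})$ (over all permutations $\delta$ of $[n]$), together with the trivial inequalities $0\le x_i\le1$ for $i\in[n]$ and $\sum_{i\in N_k}x_i\le1$ for $k\in[t]$, provide a complete linear description of $\operatorname{conv}(X)$; that is, $\operatorname{conv}(X)$ is exactly the set of $(w,x)\in\mathbb{R}\times\mathbb{R}^n$ satisfying all these inequalities.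
   Context: For a non-negative integer $m$, $[m]=\{1,\dots,m\}$ with $[0]=\varnothing$. Let $n,t$ be positive integers, $f:\mathbb{R}\to\mathbb{R}$ a concave function with $f(0)=0$, $a\in\mathbb{R}^n$ with non-negative entries, $b\in\mathbb{R}^n$, and $\{N_k\}_{k\in[t]}$ a partition of $[n]$ into consecutive blocks: with $i_0:=0$ and $i_k:=\sum_{j=1}^k|N_j|$, $N_k=\{i_{k-1}+1,\dots,i_k\}$. Within each block the entries of $a$ are ascending: $a_{i_{k-1}+1}\le\cdots\le a_{i_k}$ for all $k\in[t]$. For $S\subseteq[n]$, $a(S):=\sum_{i\in S}a_i$. Define $$X=\Big\{(w,x)\in\mathbb{R}\times\{0,1\}^n:\ w\ge f(a^\top x)+b^\top x,\ \sum_{i\in N_k}x_i\le1\ \forall k\in[t]\Big\}.$$ For a permutation $\delta$ of $[n]$, let $\delta(j):=\{\delta_1,\dots,\delta_j\}$ and $\delta(0)=\varnothing$. The lifting coefficients are defined recursively for $j=1,\dots,n$ by $$\eta^{\delta}_{\delta_j}:=\min_{S}\Big\{ f(a(S))-\sum_{i\in S\setminus\{\delta_j\}}\eta^{\delta}_i \;:\; S\subseteq\delta(j),\ |S\cap N_k|\le 1\ \ \forall k\in[t],\ \delta_j\in S\Big\}.$$ *)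

(* Defs.v *)
From mathcomp Require Import all_boot all_order all_fingroup all_algebra.
From mathcomp Require Import all_classical all_reals all_analysis.
Set Implicit Arguments.
Unset Strict Implicit.
Unset Printing Implicit Defensive.
Import Order.TTheory GRing.Theory Num.Theory.
Local Open Scope ring_scope.

Definition convex_hull (R : realType) (E : lmodType R) (A : set E) : set E :=
  smallest (@convex_set R E) A.

Definition concave (R : realType) (f : R -> R) : Prop :=
  convex_function (E := R^o) setT (fun x : R => - f x : R^o).

Definition affinely_independent (R : realType) (E : lmodType R) (m : nat)
    (p : 'I_m -> E) : Prop :=
  forall c : 'I_m -> R,
    \sum_(i < m) c i = 0 -> \sum_(i < m) c i *: p i = 0 -> forall i, c i = 0.

(* [A] has dimension [d]: the maximal number of affinely independent points
   of [A] is [d + 1].  The empty set has no dimension in this sense. *)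
Definition has_affine_dim (R : realType) (E : lmodType R) (A : set E) (d : nat)
    : Prop :=
  (exists p : 'I_d.+1 -> E, (forall i, A (p i)) /\ affinely_independent p) /\
  (forall p : 'I_d.+2 -> E, (forall i, A (p i)) -> ~ affinely_independent p).

(* The inequality [lhs p <= rhs p] is valid for [P] and the face of [P] on
   which it is tight has dimension [dim P - 1].  Meant for affine [lhs] and
   [rhs]. *)
Definition facet_defining (R : realType) (E : lmodType R) (P : set E)
    (lhs rhs : E -> R) : Prop :=
  (forall p, P p -> lhs p <= rhs p) /\
  exists d, has_affine_dim P d.+1 /\
            has_affine_dim (P `&` [set p | lhs p = rhs p])%classic d.

(* Indices are 0-based: [n] is ['I_n], and the block N_(k+1) of the
   mathematical text is [N k]; [block_end N k] is i_k, the total size of the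
   first [k] blocks. *)
Definition block_end (n t : nat) (N : 'I_t -> {set 'I_n}) (k : nat) : nat :=
  (\sum_(l < t | (l < k)%N) #|N l|)%N.

Definition consecutive_partition (n t : nat) (N : 'I_t -> {set 'I_n}) : Prop :=
  [/\ injective N,
      finset.partition (N @: [set: 'I_t]) [set: 'I_n]
    & forall (k : 'I_t) (i : 'I_n),
        (i \in N k) = (block_end N k <= i < block_end N k.+1)%N].

Definition vsum (R : realType) (n : nat) (a : 'rV[R]_n) (S : {set 'I_n}) : R :=
  \sum_(i in S) a 0 i.

Definition mixed_set (R : realType) (n t : nat) (f : R -> R) (a b : 'rV[R]_n)
    (N : 'I_t -> {set 'I_n}) : set (R^o * 'rV[R]_n)%type :=
  [set p : R^o * 'rV[R]_n | [/\ forall i, p.2 0 i = 0 \/ p.2 0 i = 1,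
               f (\sum_i a 0 i * p.2 0 i) + \sum_i b 0 i * p.2 0 i <= p.1
             & forall k, \sum_(i in N k) p.2 0 i <= 1]]%classic.

(* The set of the first [j] entries of the permutation [d]. *)
Definition prefix_set (n : nat) (d : 'S_n) (j : nat) : {set 'I_n} :=
  [set d i | i : 'I_n & (i < j)%N].

Section Lifting.
Variables (R : realType) (n t : nat) (f : R -> R) (a : 'rV[R]_n).
Variables (N : 'I_t -> {set 'I_n}) (d : 'S_n).

Definition lift_feasible (j : 'I_n) (S : {set 'I_n}) : bool :=
  [&& S \subset prefix_set d j.+1, [forall k, (#|S :&: N k| <= 1)%N]
    & d j \in S].

Definition lift_objective (eta : 'I_n -> R) (j : 'I_n) (S : {set 'I_n}) : R :=
  f (vsum a S) - \sum_(i in S :\ d j) eta i.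

(* The singleton [set d j] is always feasible, so this is the minimum of the
   objective over the feasible sets. *)
Definition lift_min (eta : 'I_n -> R) (j : 'I_n) : R :=
  lift_objective eta j
    [arg min_(S < [set d j] | lift_feasible j S) lift_objective eta j S]%O.

(* Coefficients of the first [m] entries of [d]; 0 on the other indices.
   [(d^-1)%g i] is the position of [i] in [d]. *)
Fixpoint lift_upto (m : nat) (i : 'I_n) : R :=
  if m is m'.+1 then
    if ((d^-1)%g i : nat) == m' then lift_min (lift_upto m') ((d^-1)%g i)
    else lift_upto m' i
  else 0.

Definition lift_coef : 'I_n -> R := lift_upto n.

Lemma lift_feasible1 (j : 'I_n) : lift_feasible j [set d j].
Proof.
apply/and3P; split; last by rewrite finset.set11.
  by rewrite finset.sub1set; apply/imsetP; exists j; rewrite ?inE.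
by apply/forallP => k; rewrite -(cards1 (d j)) subset_leq_card ?finset.subsetIl.
Qed.

Lemma lift_upto_stable (j : 'I_n) (m : nat) : (j < m)%N ->
  lift_upto m (d j) = lift_min (lift_upto j) j.
Proof.
elim: m => // m IH; rewrite ltnS leq_eqVlt /= permK => /orP[/eqP<-|jm].
  by rewrite eqxx.
by rewrite (ltn_eqF jm) IH.
Qed.

(* The defining recursion of the lifting coefficients. *)
Lemma lift_coef_min (j : 'I_n) :
  (exists2 S, lift_feasible j S & lift_coef (d j) = lift_objective lift_coef j S)
  /\ (forall S, lift_feasible j S ->
        lift_coef (d j) <= lift_objective lift_coef j S).
Proof.
have objE S : lift_feasible j S ->
    lift_objective (lift_upto j) j S = lift_objective lift_coef j S.
  move=> /and3P[/fintype.subsetP sub _ _]; congr (_ - _); apply: eq_bigr => i.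
  rewrite !inE => /andP[idj /sub /imsetP[l]]; rewrite !inE ltnS => lj iE.
  have lj' : (l < j)%N.
    by rewrite ltn_neqAle lj andbT; apply: contra idj => /eqP/val_inj <-; rewrite iE.
  by rewrite iE /lift_coef (lift_upto_stable lj') (lift_upto_stable (ltn_ord l)).
rewrite [lift_coef (d j)](lift_upto_stable (ltn_ord j)) /lift_min.
case: Order.TotalTheory.arg_minP => [|S fS minS]; first exact: lift_feasible1.
split; first by exists S; rewrite ?objE.
by move=> T fT; rewrite -(objE _ fT) minS.
Qed.

End Lifting.

Definition lepi_coef (R : realType) (n t : nat) (f : R -> R) (a b : 'rV[R]_n)
    (N : 'I_t -> {set 'I_n}) (d : 'S_n) (j : 'I_n) : R :=
  lift_coef f a N d (d j) + b 0 (d j).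

Definition epi_coef (R : realType) (n : nat) (f : R -> R) (a b : 'rV[R]_n)
    (d : 'S_n) (j : 'I_n) : R :=
  f (vsum a (prefix_set d j.+1)) - f (vsum a (prefix_set d j)) + b 0 (d j).

(* Main.v *)
(* Each set allowed by the block constraints satisfies the lifted inequality,
   because of the minimum defining the coefficient of its last element, and the
   minimizers of the n lifting problems are triangular with respect to the
   permutation, so together with the empty set they span a facet.  Comparison
   with the extended polymatroid coefficients is the decreasing-increments
   property of [f].
   For the linear description, a point [x] of the partition polytope is encoded
   by its tail sums z_i, the sum of the x_l with l >= i in the block of i.
   Sorting the indices by decreasing z gives a permutation that is ascending in
   each block.  Along such a permutation the largest elements of the prefix in
   the different blocks form a tight set, and x is the convex combination of
   these sets with the successive differences of z as weights, as for the
   Lovasz extension of a submodular function on a product of chains. *)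
Require Import Defs.
From mathcomp Require Import all_boot all_order all_fingroup all_algebra.
From mathcomp Require Import all_classical all_reals all_analysis.
From mathcomp Require Import ring lra.
Set Implicit Arguments.
Unset Strict Implicit.
Unset Printing Implicit Defensive.
Import Order.TTheory GRing.Theory Num.Theory.
Local Open Scope ring_scope.

(** * Concave functions *)

Lemma concave_conv (R : realType) (f : R -> R) (t x y : R) :
  concave f -> 0 <= t -> t <= 1 ->
  t * f x + (1 - t) * f y <= f (t * x + (1 - t) * y).
Proof.
move=> fc t0 t1.
have : - f (t * x + (1 - t) * y) <= t * - f x + (1 - t) * - f y.
  exact: (fc (Itv01 t0 t1) x y (in_setT _) (in_setT _)).
lra.
Qed.

(** Both [x + h] and [y] are convex combinations of [x] and [y + h], with the two weights exchanged;
    the two concavity inequalities add up to the claim. *)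
Lemma concave_decreasing_increments (R : realType) (f : R -> R) (x y h : R) :
  concave f -> x <= y -> 0 <= h -> f (y + h) - f y <= f (x + h) - f x.
Proof.
move=> fc xy h0; have [e|L0] := eqVneq (y + h - x) 0.
  have -> : h = 0 by lra.
  by rewrite !addr0 !subrr.
have Lp : 0 < y + h - x by rewrite lt_neqAle eq_sym L0; lra.
have t0 : 0 <= h / (y + h - x) by rewrite divr_ge0 // ltW.
have t1 : h / (y + h - x) <= 1 by rewrite ler_pdivrMr // mul1r; lra.
have := concave_conv (y + h) x fc t0 t1.
have := concave_conv x (y + h) fc t0 t1.
have -> : h / (y + h - x) * (y + h) + (1 - h / (y + h - x)) * x = x + h.
  by field.
have -> : h / (y + h - x) * x + (1 - h / (y + h - x)) * (y + h) = y.
  by field.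
lra.
Qed.

(** * Convex combinations and affine dependence *)

Lemma convex_set_sum (R : realType) (E : lmodType R) (A : set E) (m : nat)
    (c : 'I_m -> R) (p : 'I_m -> E) :
  convex_set A -> (forall i, 0 <= c i) -> \sum_i c i = 1 ->
  (forall i, A (p i)) -> A (\sum_i c i *: p i).
Proof.
move=> cA; elim: m c p => [|m IH] c p c0 c1 Ap.
  by move: c1; rewrite big_ord0 => /esym/eqP; rewrite oner_eq0.
rewrite big_ord_recl; move: c1; rewrite big_ord_recl => c1.
set s := \sum_(i < m) c (lift ord0 i) in c1.
have s0 : 0 <= s by apply: sumr_ge0.
have [se|sn] := eqVneq s 0.
  have cz i : c (lift ord0 i) = 0.
    by apply: (psumr_eq0P (P := xpredT) _ se) => // j _.
  rewrite big1 => [|i _]; last by rewrite cz scale0r.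
  have -> : c ord0 = 1 by lra.
  by rewrite scale1r addr0.
have t1 : c ord0 <= 1 by lra.
(* Dividing by the total weight [s] of the remaining points makes them a convex combination, so
   binary convexity applies. *)
have -> : \sum_(i < m) c (lift ord0 i) *: p (lift ord0 i) =
    (1 - c ord0) *: \sum_(i < m) (c (lift ord0 i) / s) *: p (lift ord0 i).
  rewrite scaler_sumr; apply: eq_bigr => i _; rewrite scalerA.
  have -> : 1 - c ord0 = s by lra.
  by rewrite mulrCA divff ?mulr1.
apply/set_mem; apply: (cA _ _ (Itv01 (c0 ord0) t1)); apply/mem_set => //.
apply: IH => // [i|]; first by rewrite divr_ge0.
by rewrite -mulr_suml divff.
Qed.

Lemma exists_left_kernel (F : fieldType) (m k : nat) (M : 'M[F]_(k, m)) :
  (m < k)%N -> exists2 c : 'rV_k, c != 0 & c *m M = 0.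
Proof.
move=> mk; have : kermx M != 0.
  by rewrite kermx_eq0 /row_free neq_ltn (leq_ltn_trans (rank_leq_col M)).
by case/rowV0Pn=> c /sub_kermxP cM c0; exists c.
Qed.

(** A column of ones in front of the points turns the condition on the sum of the coefficients into
    one more linear equation. *)
Lemma affine_dependence (R : realType) (m k : nat) (p : 'I_k -> 'rV[R]_m) :
  (m.+1 < k)%N -> exists2 c : 'I_k -> R, exists i, c i != 0
    & \sum_i c i = 0 /\ \sum_i c i *: p i = 0.
Proof.
move=> mk; pose M := row_mx (const_mx 1 : 'cV[R]_k) (\matrix_i p i).
have [//|c cn] := @exists_left_kernel _ _ _ M; rewrite mul_mx_row => e.
exists (c 0); first by apply/rV0Pn.
move: e; rewrite -row_mx0 => /eq_row_mx[e1 e2]; split.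
  move/rowP: e1 => /(_ 0); rewrite !mxE => s0; rewrite -[RHS]s0.
  by under [RHS]eq_bigr do rewrite mxE mulr1.
by rewrite -[RHS]e2 mulmx_sum_row; under [RHS]eq_bigr do rewrite rowK.
Qed.

Lemma sum_fst (R : realType) (U V : lmodType R) (k : nat) (p : 'I_k -> U * V) :
  (\sum_i p i).1 = \sum_i (p i).1.
Proof. exact: (big_morph (fun q : U * V => q.1) (fun _ _ => erefl) erefl). Qed.

Lemma sum_snd (R : realType) (U V : lmodType R) (k : nat) (p : 'I_k -> U * V) :
  (\sum_i p i).2 = \sum_i (p i).2.
Proof. exact: (big_morph (fun q : U * V => q.2) (fun _ _ => erefl) erefl). Qed.

Lemma not_affinely_independent (R : realType) (n : nat)
    (p : 'I_n.+3 -> (R^o * 'rV[R]_n)%type) : ~ affinely_independent p.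
Proof.
move=> ind; pose q i := row_mx ((p i).1%:M : 'rV[R]_1) (p i).2.
have [//|c [i ci] [c0 cq]] := @affine_dependence R (1 + n) n.+3 q.
case/eqP: ci; apply: ind => //; apply: injective_projections => /=.
  move: cq => /(congr1 (fun u => lsubmx u 0 0)); rewrite linear_sum summxE !mxE => q0.
  rewrite sum_fst -[RHS]q0; apply: eq_bigr => l _.
  by rewrite /= /q scale_row_mx row_mxKl !mxE mulr1n.
move: cq => /(congr1 (@rsubmx R 1 1 n)); rewrite linear_sum linear0 => q0.
rewrite sum_snd -[RHS]q0; apply: eq_bigr => l _.
rewrite /= /q scale_row_mx; exact/esym/row_mxKr.
Qed.

(** The first components depend linearly on the second ones, so a dependence among the latter
    extends to the pairs. *)
Lemma not_affinely_independent_graph (R : realType) (n : nat) (c : 'rV[R]_n)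
    (p : 'I_n.+2 -> (R^o * 'rV[R]_n)%type) :
  (forall i, \sum_l c 0 l * (p i).2 0 l = (p i).1) -> ~ affinely_independent p.
Proof.
move=> pc ind.
have [//|u [i ui] [u0 up]] := @affine_dependence R n n.+2 (fun i => (p i).2).
case/eqP: ui; apply: ind => //; apply: injective_projections => /=; last first.
  by rewrite sum_snd.
rewrite sum_fst; under eq_bigr do rewrite /= -pc /GRing.scale /= mulr_sumr.
rewrite exchange_big big1 //= => l _; under eq_bigr do rewrite mulrCA.
move/rowP/(_ l): up; rewrite summxE mxE => up.
rewrite -mulr_sumr [X in _ * X](_ : _ = 0) ?mulr0 // -[RHS]up.
by apply: eq_bigr => m _; rewrite mxE.
Qed.

(** * Independent sets, validity of the lifted coefficients, comparison with the polymatroid ones *)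

Section Blocks.
Variables (R : realType) (n t : nat) (f : R -> R) (a : 'rV[R]_n).
Variables (N : 'I_t -> {set 'I_n}) (blk : 'I_n -> 'I_t).
Hypothesis blkE : forall i k, (i \in N k) = (blk i == k).
Hypothesis f_concave : concave f.
Hypothesis f0 : f 0 = 0.
Hypothesis a_ge0 : forall i, 0 <= a 0 i.

Definition independent (S : {set 'I_n}) : bool :=
  [forall k, (#|S :&: N k| <= 1)%N].

Lemma independentP (S : {set 'I_n}) :
  reflect {in S &, injective blk} (independent S).
Proof.
apply: (iffP forallP) => [S1 i l iS lS e|inj k].
  by apply: (card_le1_eqP (S1 (blk i))); rewrite inE blkE ?iS ?lS ?e eqxx.
apply/card_le1_eqP => i l; rewrite !inE !blkE => /andP[iS /eqP ei] /andP[lS /eqP el].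
by apply: inj; rewrite ?ei ?el.
Qed.

Lemma independent_sub (S T : {set 'I_n}) :
  T \subset S -> independent S -> independent T.
Proof.
move=> /fintype.subsetP TS /independentP iS; apply/independentP.
by move=> i l /TS ? /TS ?; apply: iS.
Qed.

Lemma mem_prefix (d : 'S_n) m i : (i \in prefix_set d m) = ((d^-1)%g i < m)%N.
Proof.
apply/imsetP/idP => [[l]|im]; first by rewrite inE => lm ->; rewrite permK.
by exists ((d^-1)%g i); rewrite ?inE ?permKV.
Qed.

Lemma prefix_setS (d : 'S_n) (j : 'I_n) :
  prefix_set d j.+1 = d j |: prefix_set d j.
Proof.
apply/setP => i; rewrite !inE !mem_prefix ltnS leq_eqVlt; congr (_ || _).
by apply/eqP/eqP => [/val_inj<-|->]; rewrite ?permK ?permKV.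
Qed.

Lemma notin_prefix (d : 'S_n) (j : 'I_n) : d j \notin prefix_set d j.
Proof. by rewrite mem_prefix permK ltnn. Qed.

Lemma vsumD1 i (S : {set 'I_n}) : i \in S -> vsum a S = a 0 i + vsum a (S :\ i).
Proof. exact: big_setD1. Qed.

Lemma vsum0 : vsum a finset.set0 = 0.
Proof. exact: big_set0. Qed.

Lemma vsum_subset (S T : {set 'I_n}) : S \subset T -> vsum a S <= vsum a T.
Proof.
move=> /finset.setIidPr ST; rewrite /vsum [leRHS](big_setID S) /= ST lerDl.
exact: sumr_ge0.
Qed.

(* The inequality is the defining minimum at the last element of [S]. *)
Lemma lift_coef_valid (d : 'S_n) (S : {set 'I_n}) :
  independent S -> \sum_(i in S) lift_coef f a N d i <= f (vsum a S).
Proof.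
move=> indS; have [->|[i0 i0S]] := set_0Vmem S.
  by rewrite big_set0 vsum0 f0.
have [i iS imax] := @arg_maxnP _ i0 (fun i => i \in S) (fun i => (d^-1)%g i) i0S.
have fS : lift_feasible N d ((d^-1)%g i) S.
  apply/and3P; split=> //; last by rewrite permKV.
  by apply/fintype.subsetP => l /imax; rewrite mem_prefix ltnS.
have := (lift_coef_min f a N d _).2 _ fS.
by rewrite /lift_objective permKV [X in _ -> X <= _](big_setD1 i iS) /= lerBrDr.
Qed.

(** At a minimizer [S], validity for [S :\ d j] bounds the coefficient below by the increment of [f]
    from [S :\ d j] to [S]. As [S :\ d j] lies in the prefix, the increment at the prefix is no
    larger. *)
Lemma epi_le_lift (d : 'S_n) (j : 'I_n) :
  f (vsum a (prefix_set d j.+1)) - f (vsum a (prefix_set d j))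
    <= lift_coef f a N d (d j).
Proof.
have [[S /and3P[Ssub indS jS] ->] _] := lift_coef_min f a N d j.
rewrite /lift_objective.
have SD : S :\ d j \subset prefix_set d j.
  apply/fintype.subsetP => i; rewrite !inE => /andP[ij /(fintype.subsetP Ssub)].
  by rewrite prefix_setS !inE (negbTE ij).
have val := lift_coef_valid d (independent_sub (finset.subsetDl S [set d j]) indS).
have := concave_decreasing_increments f_concave (vsum_subset SD) (a_ge0 (d j)).
rewrite prefix_setS /vsum (big_setU1 _ (notin_prefix d j)) /=.
rewrite (big_setD1 _ jS) /= ![a 0 (d j) + _]addrC -!/(vsum _ _).
lra.
Qed.

(** * Tight sets along ascending permutations *)

Hypothesis a_asc : forall i l : 'I_n, blk i = blk l -> (i <= l)%N -> a 0 i <= a 0 l.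

Definition ascending (d : 'S_n) : Prop :=
  forall i l : 'I_n, blk i = blk l -> (i < l)%N -> ((d^-1)%g i < (d^-1)%g l)%N.

(** For an independent [S] inside [P], this says that [S] consists of the largest elements of [P] in
    the blocks that [P] meets. *)
Definition dominates (S P : {set 'I_n}) : Prop :=
  forall i, i \in P -> exists2 l, l \in S & blk l = blk i /\ (i <= l)%N.

(** The map [h] moves each element of [T] upwards in its block into [U]; independence of [T] makes
    it injective. *)
Lemma vsum_dominates (U T : {set 'I_n}) :
  independent T -> dominates U T -> vsum a T <= vsum a U.
Proof.
move=> /independentP indT dom.
pose h l := odflt l [pick l' in U | (blk l' == blk l) && (l <= l')%N].
have hP l : l \in T -> [/\ h l \in U, blk (h l) = blk l & (l <= h l)%N].
  move=> /dom[l' l'U [e ll']]; rewrite /h.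
  case: pickP => [x /and3P[xU /eqP xe lx]|/(_ l')] //=.
  by rewrite l'U e eqxx ll'.
have hT : {in T &, injective h}.
  move=> l l' lT l'T e; apply: indT => //.
  by have [_ <- _] := hP _ lT; have [_ <- _] := hP _ l'T; rewrite e.
have hU : h @: T \subset U by apply/fintype.subsetP => _ /imsetP[l /hP[? _ _] ->].
apply: le_trans (vsum_subset hU); rewrite /vsum big_imset //=.
by apply: ler_sum => l /hP[_ e lh]; apply: a_asc.
Qed.

(* With [i] the next element of an ascending permutation and [S] a tight set
   dominating the prefix, let [P] be the element of [S] in the block of [i], if
   any, and [U] the rest of [S].  A minimizer [i |: T] for the coefficient of
   [i] satisfies, by concavity, [f(U + i) - f(T + i) <= f(U + P) - f(T + P)],
   while [f(U + P)] is tight and [f(T + P)] is bounded below by validity; hence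
   [i |: U] is a minimizer too. *)
Lemma exists_tight (d : 'S_n) (m : nat) : ascending d -> (m <= n)%N ->
  exists S : {set 'I_n}, [/\ S \subset prefix_set d m, independent S,
    dominates S (prefix_set d m)
    & \sum_(i in S) lift_coef f a N d i = f (vsum a S)].
Proof.
move=> asc; elim: m => [_|m IH mn].
  exists finset.set0; split; first exact: finset.sub0set.
  - by apply/independentP => i l; rewrite finset.in_set0.
  - by move=> i; rewrite mem_prefix ltn0.
  by rewrite big_set0 vsum0 f0.
have [S [Ssub indS domS tS]] := IH (ltnW mn).
pose j := Ordinal mn; pose i := d j.
have ->: prefix_set d m.+1 = i |: prefix_set d m by exact: (prefix_setS d j).
set K := N (blk i); pose U := S :\: K; pose P := S :&: K.
have iS : i \notin S.
  by apply: contra (notin_prefix d j) => /(fintype.subsetP Ssub).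
have iU : i \notin U by rewrite inE negb_and iS orbT.
(* The order of [d] makes [i] the largest element of its block so far, so it can replace [P] in the
   dominating set. *)
have earlier l : l \in prefix_set d m -> blk l = blk i -> (l < i)%N.
  rewrite mem_prefix => lm e; rewrite ltn_neqAle leqNgt; apply/andP; split.
    by apply: contraL lm => /eqP/val_inj->; rewrite permK ltnn.
  by apply/negP => /(asc _ _ (esym e)); rewrite permK /= ltnNge (ltnW lm).
have indU : independent (i |: U).
  apply/independentP => l l'; rewrite !inE !blkE.
  case/predU1P => [->|/andP[lk lS]]; case/predU1P => [->|/andP[lk' lS']] e //.
  - by rewrite e eqxx in lk'.
  - by rewrite e eqxx in lk.
  exact: (independentP _ indS).
have dU : dominates (i |: U) (i |: prefix_set d m).
  move=> l; rewrite in_setU1 => /predU1P[->|lm]; first by exists i; rewrite ?inE ?eqxx.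
  have [l' l'S [e ll']] := domS _ lm.
  have [e'|ne] := eqVneq (blk l') (blk i); last first.
    by exists l' => //; rewrite !inE blkE ne l'S orbT.
  exists i; rewrite ?inE ?eqxx // -e' e; split => //.
  by apply/ltnW/earlier; rewrite // -e.
have subU : i |: U \subset i |: prefix_set d m.
  apply/finset.setUS/fintype.subsetP => l /finset.setDP[/(fintype.subsetP Ssub)] //.
exists (i |: U); split => //; apply/eqP; rewrite eq_le lift_coef_valid //=.
rewrite big_setU1 //= {1}/i.
have [[S' /and3P[S'sub indS' iS'] ->] _] := lift_coef_min f a N d j.
rewrite /lift_objective -/i; set T := S' :\ i.
have Tblk l : l \in T -> blk l != blk i.
  rewrite !inE => /andP[li lS']; apply: contraNneq li => e.
  by apply/eqP/(independentP _ indS').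
have Tsub : T \subset prefix_set d m.
  apply/fintype.subsetP => l; rewrite !inE => /andP[li /(fintype.subsetP S'sub)].
  by rewrite prefix_setS !inE (negbTE li).
(* [T] avoids the block of [i], and [P] lies in that block. *)
have indTP : independent (T :|: P).
  apply/independentP => l l'; rewrite ![_ \in T :|: P]finset.in_setU.
  case/orP => h; case/orP => h' e.
  - by move: h h'; rewrite !inE => /andP[_ h] /andP[_ h']; apply: (independentP _ indS').
  - by move: h' (Tblk _ h); rewrite !inE blkE e => /andP[_ ->].
  - by move: h (Tblk _ h'); rewrite !inE blkE e => /andP[_ ->].
  by move: h h'; rewrite !inE => /andP[h _] /andP[h' _]; apply: (independentP _ indS).
have TP0 : [disjoint T & P].
  rewrite -setI_eq0; apply/eqP/setP => l; rewrite finset.in_setI finset.in_set0.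
  apply/negP => /andP[/Tblk lT]; rewrite inE blkE (negbTE lT) andbF //.
have aTU : vsum a T <= vsum a U.
  apply: vsum_dominates.
    by apply: independent_sub indTP; apply: finset.subsetUl.
  move=> l lT; have [l' l'S [e ll']] := domS l (fintype.subsetP Tsub l lT).
  by exists l'; rewrite // !inE blkE e Tblk.
have aP : vsum a P <= a 0 i.
  have [->|[l lP]] := set_0Vmem P; first by rewrite vsum0.
  have [lS /eqP lk] : l \in S /\ blk l == blk i.
    by move: lP; rewrite inE blkE => /andP.
  have -> : P = [set l].
    apply/eqP; rewrite eq_sym eqEcard finset.sub1set lP cards1.
    exact: (forallP indS).
  rewrite /vsum finset.big_set1; apply: a_asc => //.
  by apply/ltnW/earlier => //; apply: (fintype.subsetP Ssub).
have aTP0 : 0 <= vsum a U - vsum a T by rewrite subr_ge0.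
have xy : vsum a T + vsum a P <= vsum a T + a 0 i by rewrite lerD2l.
have := concave_decreasing_increments f_concave xy aTP0.
have vTP := lift_coef_valid d indTP.
have eTP (g : 'I_n -> R) :
    \sum_(l in T :|: P) g l = \sum_(l in T) g l + \sum_(l in P) g l.
  by rewrite -bigU //=; apply: eq_bigl => l; rewrite finset.in_setU.
have aTPE : vsum a (T :|: P) = vsum a T + vsum a P by exact: eTP.
have aS : vsum a S = vsum a P + vsum a U by exact: big_setID.
have eS : \sum_(l in S) lift_coef f a N d l =
  \sum_(l in P) lift_coef f a N d l + \sum_(l in U) lift_coef f a N d l by exact: big_setID.
have aS' : vsum a S' = a 0 i + vsum a T by exact: vsumD1.
have aU : vsum a (i |: U) = a 0 i + vsum a U by exact: big_setU1.
rewrite aS eS in tS; rewrite aTPE eTP in vTP; rewrite aS' aU.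
have -> : vsum a T + vsum a P + (vsum a U - vsum a T) = vsum a P + vsum a U by lra.
have -> : vsum a T + a 0 i + (vsum a U - vsum a T) = a 0 i + vsum a U by lra.
rewrite [vsum a T + a 0 i]addrC.
lra.
Qed.

(** * Sorting, tail sums and the decomposition into tight sets *)

(** Breaking ties by the index is what later makes the permutation ascending in each block. *)
Lemma exists_sorting_perm (z : 'I_n -> R) : exists d : 'S_n,
  forall i j : 'I_n, (i < j)%N ->
    z (d j) <= z (d i) /\ (z (d i) = z (d j) -> (d i <= d j)%N).
Proof.
pose leT (i j : 'I_n) := (z j < z i) || ((z i == z j) && (i <= j)%N).
have leT_total : total leT.
  by move=> i j; rewrite /leT; case: (ltgtP (z i) (z j)) => //= _; exact: leq_total.
have leT_trans : transitive leT.
  move=> j i k /orP[ji|/andP[/eqP ij lij]] /orP[kj|/andP[/eqP jk ljk]]; apply/orP.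
  - by left; apply: lt_trans kj ji.
  - by left; rewrite -jk.
  - by left; rewrite ij.
  by right; rewrite ij jk eqxx (leq_trans lij).
have /tuple_permP[d e] : perm_eq (sort leT (enum 'I_n)) (ord_tuple n).
  by rewrite perm_sort.
exists d => i j ij.
have szs : size (sort leT (enum 'I_n)) = n by rewrite size_sort size_enum_ord.
have nthE (k : 'I_n) : nth i (sort leT (enum 'I_n)) k = d k.
  by rewrite e -tnth_nth tnth_mktuple tnth_ord_tuple.
have := sorted_ltn_nth leT_trans i (sort_sorted leT_total (enum 'I_n)).
move=> /(_ i j); rewrite !inE szs !ltn_ord !nthE => /(_ isT isT ij).
by case/orP => [lt|/andP[/eqP-> ->]] //; split; [exact: ltW|move=> E; rewrite E ltxx in lt].
Qed.

Definition tail_sum (x : 'I_n -> R) (i : 'I_n) : R :=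
  \sum_(l | (blk l == blk i) && (i <= l)%N) x l.

(** At the largest index where [x] and [y] differ, all other terms of the two tail sums agree. *)
Lemma tail_sum_inj (x y : 'I_n -> R) : tail_sum x =1 tail_sum y -> x =1 y.
Proof.
move=> xy i; apply/eqP; apply: contraT => ne.
have [l nel lmax] := @arg_maxnP _ i (fun i => x i != y i) (fun i => val i) ne.
case/eqP: nel; have := xy l.
rewrite /tail_sum !(bigD1 (P := fun m => (blk m == blk l) && (l <= m)%N) l) /= ?eqxx ?leqnn //.
rewrite (eq_bigr y); first exact: addIr.
move=> m /andP[/andP[_ lm] ml]; apply/eqP/contraT => /lmax /= mle.
by case/eqP: ml; apply: val_inj; apply/eqP; rewrite eqn_leq mle lm.
Qed.

(** For [i] in the prefix, its tail meets [S] exactly in the element dominating [i]. Otherwise it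
    misses [S]: an element of [S] above [i] in the block comes after [i] in [d], which would put [i]
    in the prefix. *)
Lemma tail_sum_dominating (d : 'S_n) m (S : {set 'I_n}) (i : 'I_n) :
  ascending d -> S \subset prefix_set d m -> independent S ->
  dominates S (prefix_set d m) ->
  tail_sum (fun l => (l \in S)%:R) i = (i \in prefix_set d m)%:R.
Proof.
move=> asc /fintype.subsetP Sm /independentP indS dom; rewrite /tail_sum.
have [/dom[l lS [e il]]|im] := boolP (i \in _).
  rewrite (bigD1 l) ?e ?eqxx //= lS big1 ?addr0 // => l' /andP[/andP[/eqP e' _] ne].
  case: (boolP (l' \in S)) => // l'S; case/eqP: ne.
  by apply: indS; rewrite // e e'.
rewrite big1 // => l /andP[/eqP e il]; case: (boolP (l \in S)) => // /Sm lm.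
have li : i != l by apply: contraNneq im => ->.
have := asc i l (esym e); rewrite ltn_neqAle il andbT -val_eqE in li *.
move=> /(_ li) pil; case/negP: im; move: lm; rewrite !mem_prefix.
exact: ltn_trans.
Qed.

(* Abel summation along the prefixes of [d] with weights
   [z (d (m - 1)) - z (d m)], where [z (d (-1)) = 1] and [z (d n) = 0]. *)
Lemma exists_prefix_weights (z : 'I_n -> R) (d : 'S_n) :
  (forall i, 0 <= z i <= 1) ->
  (forall i j : 'I_n, (i < j)%N -> z (d j) <= z (d i)) ->
  exists c : 'I_n.+1 -> R, [/\ forall m, 0 <= c m, \sum_m c m = 1
    & forall i, \sum_m c m * (i \in prefix_set d m)%:R = z i].
Proof.
move=> z01 zd.
(* Indices are shifted by one: [zs m.+1] is [z (d m)], and [insub] fails at [m = n], giving the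
   final value 0. *)
pose zs k := if k is m.+1 then oapp (fun j : 'I_n => z (d j)) 0 (insub m) else 1.
have zsE (j : 'I_n) : zs j.+1 = z (d j) by rewrite /zs valK.
have zsn : zs n.+1 = 0 by rewrite /zs insubF ?ltnn.
have tel p : (p <= n.+1)%N -> \sum_(p <= m < n.+1) (zs m - zs m.+1) = zs p.
  move=> pn; under eq_bigr do rewrite -opprB.
  by rewrite sumrN telescope_sumr // zsn sub0r opprK.
exists (fun m : 'I_n.+1 => zs m - zs m.+1); split.
- move=> [[|m] mn]; rewrite subr_ge0 /=.
    by case: insubP => [j _ _|] //=; case/andP: (z01 (d j)).
  rewrite ltnS in mn; rewrite (insubT (fun m => m < n)%N mn) /=.
  by case: insubP => [j _ jm|_] /=; [apply: zd; rewrite jm|case/andP: (z01 (d (Ordinal mn)))].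
- by rewrite -(big_mkord xpredT (fun m => zs m - zs m.+1)) tel.
(* [i] lies exactly in the prefixes longer than its position, so only a telescoping tail of the
   weights remains. *)
move=> i; rewrite -[in RHS](permKV d i) -zsE -[RHS]tel; last exact/leqW/ltn_ord.
under eq_bigr do rewrite mem_prefix.
rewrite -(big_mkord xpredT (fun m => (zs m - zs m.+1) * ((d^-1)%g i < m)%N%:R)).
rewrite (@big_cat_nat _ _ _ ((d^-1)%g i).+1) //=; last exact/leqW/ltn_ord.
rewrite [X in X + _]big_nat_cond big1 ?add0r => [|m /andP[/andP[_ mi] _]]; last first.
  by rewrite ltnNge -ltnS mi mulr0.
by apply: eq_big_nat => m /andP[im _]; rewrite im mulr1.
Qed.

Definition indicator (S : {set 'I_n}) : 'rV[R]_n := \row_i (i \in S)%:R.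

Lemma sum_indicator (c : 'I_n -> R) (S : {set 'I_n}) :
  \sum_i c i * indicator S 0 i = \sum_(i in S) c i.
Proof.
rewrite [RHS]big_mkcond; apply: eq_bigr => i _; rewrite mxE.
by case: ifP; rewrite ?mulr1 ?mulr0.
Qed.

Lemma exists_tight_decomposition (x : 'rV[R]_n) :
  (forall i, 0 <= x 0 i) -> (forall k, \sum_(i in N k) x 0 i <= 1) ->
  exists d : 'S_n, exists c : 'I_n.+1 -> R, exists S : 'I_n.+1 -> {set 'I_n},
  [/\ forall m, 0 <= c m, \sum_m c m = 1,
      forall m, independent (S m) /\
        \sum_(i in S m) lift_coef f a N d i = f (vsum a (S m))
    & x = \sum_m c m *: indicator (S m)].
Proof.
move=> x0 x1; pose z := tail_sum (x 0).
have z01 i : 0 <= z i <= 1.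
  rewrite sumr_ge0 //=; apply: le_trans (x1 (blk i)).
  rewrite [leRHS](bigID (fun l : 'I_n => (i <= l)%N)) /=.
  under [X in X + _]eq_bigl do rewrite blkE.
  by rewrite lerDl sumr_ge0.
have [d dP] := exists_sorting_perm z.
have zblk i l : blk i = blk l -> (i <= l)%N -> z l <= z i.
  move=> e il; rewrite /z /tail_sum [leRHS](bigID (fun m : 'I_n => (l <= m)%N)) /=.
  rewrite [X in X + _](eq_bigl (fun m => (blk m == blk l) && (l <= m)%N)).
    by rewrite lerDl sumr_ge0.
  move=> m; rewrite e; case: (blk m == _) => //=.
  by case: (leqP l m) => [/(leq_trans il)->|]; rewrite ?andbF.
(* If [l] came before [i], sorting and monotonicity of [z] in the block would force [z l = z i], and
   the tie rule would give [l <= i]. *)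
have asc : ascending d.
  move=> i l e il; have [//|li|/val_inj/perm_inj E] := ltngtP ((d^-1)%g i) ((d^-1)%g l).
    have := dP _ _ li; rewrite !permKV => -[zil zE].
    have /zE : z l = z i by apply: le_anti; rewrite zil zblk // ltnW.
    by rewrite leqNgt il.
  by rewrite E ltnn in il.
have [c [c0 c1 cz]] := exists_prefix_weights z01 (fun i j ij => (dP i j ij).1).
have ex (m : 'I_n.+1) : {S : {set 'I_n} | [/\ S \subset prefix_set d m,
    independent S, dominates S (prefix_set d m)
    & \sum_(i in S) lift_coef f a N d i = f (vsum a S)]}.
  by apply/cid/exists_tight => //; rewrite -ltnS.
exists d, c, (fun m => sval (ex m)); split => //.
  by move=> m; have [_ ? _ ?] := svalP (ex m).
(* Equality is tested on tail sums, where each [S m] counts like its whole prefix. *)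
apply/rowP; apply: tail_sum_inj => i; rewrite -/(z i) -cz /tail_sum.
under [RHS]eq_bigr do rewrite summxE.
rewrite exchange_big /=; apply: eq_bigr => m _.
have [Sm indS dom _] := svalP (ex m).
rewrite -(tail_sum_dominating i asc Sm indS dom) /tail_sum mulr_sumr.
by apply: eq_bigr => l _; rewrite !mxE.
Qed.

(** * The mixed set and its convex hull *)

Variable b : 'rV[R]_n.

(** For independent [S], the lowest point of the mixed set above the indicator of [S]. *)
Definition vertex (S : {set 'I_n}) : (R^o * 'rV[R]_n)%type :=
  (f (vsum a S) + vsum b S, indicator S).

Lemma sum_indicator_block (S : {set 'I_n}) k :
  \sum_(i in N k) indicator S 0 i = #|S :&: N k|%:R.
Proof.
rewrite -sum1_card natr_sum [LHS]big_mkcond [RHS]big_mkcond.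
apply: eq_bigr => i _; rewrite mxE finset.in_setI.
by case: (i \in S); case: (i \in N k).
Qed.

Lemma mixed_set_vertex (S : {set 'I_n}) (s : R) :
  independent S -> 0 <= s -> mixed_set f a b N (vertex S + (s, 0)).
Proof.
move=> indS s0; split=> /= [i||k]; rewrite ?addr0.
- by rewrite mxE; case: (i \in S); [right|left].
- by rewrite !sum_indicator lerDl.
by rewrite sum_indicator_block (ler_nat R _ 1) (forallP indS).
Qed.

Lemma mixed_set_indicator (p : R^o * 'rV[R]_n) : mixed_set f a b N p ->
  exists S, [/\ independent S, p.2 = indicator S
              & f (vsum a S) + vsum b S <= p.1].
Proof.
case: p => w x [/= x01 wx xN]; pose S := [set i | x 0 i == 1].
have xS : x = indicator S.
  apply/rowP => i; rewrite mxE inE.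
  by case: (x01 i) => ->; rewrite ?eqxx // eq_sym oner_eq0.
exists S; split=> //; last by move: wx; rewrite xS !sum_indicator.
apply/forallP => k; have := xN k.
by rewrite xS sum_indicator_block (ler_nat R _ 1).
Qed.

Lemma sum_lepi_coef (d : 'S_n) (x : 'rV[R]_n) :
  \sum_(j < n) lepi_coef f a b N d j * x 0 (d j) =
  \sum_i (lift_coef f a N d i + b 0 i) * x 0 i.
Proof. by rewrite [RHS](reindex_inj (@perm_inj _ d)). Qed.

Lemma sum_lepi_indicator (d : 'S_n) (S : {set 'I_n}) :
  \sum_(j < n) lepi_coef f a b N d j * indicator S 0 (d j) =
  \sum_(i in S) lift_coef f a N d i + vsum b S.
Proof. by rewrite sum_lepi_coef sum_indicator big_split. Qed.

Definition lepi_polyhedron : set (R^o * 'rV[R]_n) :=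
  [set p : R^o * 'rV[R]_n |
    [/\ forall d : 'S_n,
          \sum_(j < n) lepi_coef f a b N d j * p.2 0 (d j) <= p.1,
        forall i : 'I_n, 0 <= p.2 0 i <= 1
      & forall k : 'I_t, \sum_(i in N k) p.2 0 i <= 1]]%classic.

Lemma convex_lepi_polyhedron : convex_set lepi_polyhedron.
Proof.
move=> x y l /set_mem[x1 x2 x3] /set_mem[y1 y2 y3]; apply/mem_set.
have l0 : 0 <= l%:num by []. have l1 : l%:num <= 1 by [].
have comb c (u v u' v' : R) : 0 <= c -> c <= 1 -> u <= v -> u' <= v' ->
    c * u + (1 - c) * u' <= c * v + (1 - c) * v'.
  by move=> c0 c1 uv uv'; rewrite lerD // ler_wpM2l // subr_ge0.
have xyE i : (conv l x y).2 0 i = l%:num * x.2 0 i + (1 - l%:num) * y.2 0 i.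
  by rewrite !mxE.
have c1 (c : R) : c * 1 + (1 - c) * 1 = 1 by rewrite !mulr1 addrC subrK.
have c0 (c : R) : c * 0 + (1 - c) * 0 = 0 by rewrite !mulr0 addr0.
split=> [d|i|k].
- apply: le_trans (comb _ _ _ _ _ l0 l1 (x1 d) (y1 d)).
  rewrite !mulr_sumr -big_split /=; apply: ler_sum => i _.
  by rewrite xyE mulrDr mulrCA [X in _ + X <= _]mulrCA.
- case/andP: (x2 i) (y2 i) => xi xi' /andP[yi yi']; rewrite xyE.
  apply/andP; split; [rewrite -[leLHS](c0 l%:num)|rewrite -[leRHS](c1 l%:num)];
    exact: comb.
rewrite -[leRHS](c1 l%:num); apply: le_trans (comb _ _ _ _ _ l0 l1 (x3 k) (y3 k)).
by rewrite !mulr_sumr -big_split /=; apply: ler_sum => i _; rewrite xyE.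
Qed.

Lemma mixed_set_sub_polyhedron : (mixed_set f a b N `<=` lepi_polyhedron)%classic.
Proof.
move=> p pX; have [S [indS pS wS]] := mixed_set_indicator pX.
case: pX => p01 _ pN; split=> // [d|i].
  rewrite pS sum_lepi_indicator; apply: le_trans wS.
  by rewrite lerD2r lift_coef_valid.
by case: (p01 i) => ->; rewrite ?lexx ler01.
Qed.

(** The inequality of the permutation [d] found for [x] is tight at all the vertices used, so [w] is
    at least their weighted height. The excess [s] is added to every vertex, which raises the
    combination by [s] since the weights sum to 1. *)
Lemma lepi_polyhedron_sub_hull :
  (lepi_polyhedron `<=` convex_hull (mixed_set f a b N))%classic.
Proof.
move=> [w x] [/= wd x01 xN] A [cA XA].
have x0 i : 0 <= x 0 i by case/andP: (x01 i).
have [d [c [S [c0 c1 tS xE]]]] := exists_tight_decomposition x0 xN.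
pose s := w - \sum_m c m * (f (vsum a (S m)) + vsum b (S m)).
have s0 : 0 <= s.
  rewrite subr_ge0; apply: le_trans (wd d); rewrite sum_lepi_coef xE.
  under [leRHS]eq_bigr do rewrite summxE mulr_sumr.
  rewrite exchange_big; apply: ler_sum => m _.
  under eq_bigr do rewrite mxE mulrCA.
  by rewrite -mulr_sumr sum_indicator big_split (tS m).2.
have -> : (w, x) = \sum_m c m *: (vertex (S m) + (s, 0)).
  under eq_bigr do rewrite scalerDr; rewrite big_split -scaler_suml c1 scale1r.
  apply: injective_projections => /=; rewrite ?sum_fst ?sum_snd /= ?addr0 //.
  by rewrite /s addrC subrK.
apply: convex_set_sum => // m; apply: XA.
by apply: mixed_set_vertex; have [] := tS m.
Qed.

Lemma hull_eq_polyhedron : convex_hull (mixed_set f a b N) = lepi_polyhedron.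
Proof.
apply/seteqP; split; last exact: lepi_polyhedron_sub_hull.
exact: smallest_sub convex_lepi_polyhedron mixed_set_sub_polyhedron.
Qed.

(** * Facets *)

(** For the largest [l] with [c l != 0], only [T l] contributes to coordinate [d l], since the
    earlier sets lie in prefixes without [d l]. *)
Lemma triangular_indicators_free (d : 'S_n) (T : 'I_n -> {set 'I_n})
    (c : 'I_n -> R) :
  (forall j, d j \in T j) -> (forall j, T j \subset prefix_set d j.+1) ->
  \sum_j c j *: indicator (T j) = 0 -> forall j, c j = 0.
Proof.
move=> dT Td /rowP c0 j; apply/eqP; apply: contraT => cj.
have [l cl lmax] := @arg_maxnP _ j (fun i => c i != 0) (fun i => val i) cj.
case/eqP: cl; have := c0 (d l); rewrite summxE (bigD1 l) //= !mxE dT mulr1.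
rewrite big1 ?addr0 // => m ml; rewrite !mxE.
have [->|/lmax /= lm] := eqVneq (c m) 0; first by rewrite mul0r.
rewrite (_ : _ \in _ = false) ?mulr0 //; apply: contraNF ml.
move=> /(fintype.subsetP (Td m)); rewrite mem_prefix permK ltnS => lm'.
by apply/eqP/val_inj/eqP; rewrite eqn_leq lm lm'.
Qed.

(** The face has dimension [n]: it contains the points [q] and lies in the graph of a linear
    function. The point [(1, 0)] off the face raises the hull to the full dimension [n + 1]. *)
Lemma facet_defining_lepi (d : 'S_n) :
  facet_defining (convex_hull (mixed_set f a b N))
    (fun p => \sum_(j < n) lepi_coef f a b N d j * p.2 0 (d j))
    (fun p => p.1).
Proof.
have hull_sub := @sub_gen_smallest _ (@convex_set R (R^o * 'rV[R]_n)%type)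
  (mixed_set f a b N).
split; first by rewrite hull_eq_polyhedron => p [].
have /choice[T TP] : forall j, exists S, lift_feasible N d j S /\
    lift_coef f a N d (d j) = lift_objective f a d (lift_coef f a N d) j S.
  by move=> j; have [[S]] := lift_coef_min f a N d j; exists S.
have Ttight j : \sum_(i in T j) lift_coef f a N d i = f (vsum a (T j)).
  have [/and3P[_ _ jT] e] := TP j.
  by rewrite (big_setD1 _ jT) /= e /lift_objective subrK.
have ind0 : independent finset.set0.
  by apply/independentP => i l; rewrite finset.in_set0.
have v0 : vertex finset.set0 = 0.
  rewrite /vertex vsum0 f0 add0r /vsum big_set0; congr pair.
  by apply/rowP => i; rewrite !mxE finset.in_set0.
have vX S : independent S -> convex_hull (mixed_set f a b N) (vertex S).
  move=> indS; apply: hull_sub; rewrite -[vertex S]addr0.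
  exact: mixed_set_vertex.
have dT j : d j \in T j by have [/and3P[]] := TP j.
have Td j : T j \subset prefix_set d j.+1 by have [/and3P[]] := TP j.
(* Index 0 is mapped to the origin, the vertex of the empty set; [r] below puts [(1, 0)] in front in
   the same way. *)
pose q (i : 'I_n.+1) := oapp (fun j => vertex (T j)) 0 (unlift ord0 i).
have q0 : q ord0 = 0 by rewrite /q unlift_none.
have qS j : q (lift ord0 j) = vertex (T j) by rewrite /q liftK.
have qX i : convex_hull (mixed_set f a b N) (q i).
  rewrite /q; case: unliftP => [j _|_] /=; last by rewrite -v0; exact: vX.
  by apply: vX; have [/and3P[]] := TP j.
pose r (i : 'I_n.+2) : (R^o * 'rV[R]_n)%type := oapp q (1, 0) (unlift ord0 i).
have r0 : r ord0 = (1, 0) by rewrite /r unlift_none.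
have rS i : r (lift ord0 i) = q i by rewrite /r liftK.
have free (c : 'I_n.+1 -> R) : (\sum_i c i *: q i).2 = 0 ->
    forall j, c (lift ord0 j) = 0.
  rewrite sum_snd big_ord_recl q0 scaler0 add0r => e.
  apply: (triangular_indicators_free dT Td); rewrite -[RHS]e.
  by apply: eq_bigr => j _; rewrite qS.
have cons0 (k : nat) (c : 'I_k.+1 -> R) : (forall j, c (lift ord0 j) = 0) ->
    \sum_i c i = 0 -> forall i, c i = 0.
  move=> cS; rewrite big_ord_recl big1 // addr0 => c0 i.
  by case: (unliftP ord0 i) => [j ->|->].
exists n; split; split.
- exists r; split=> [i|c c0 ce].
    rewrite /r; case: unliftP => [j _|_] //=; apply: hull_sub.
    by rewrite -[(1, 0)]add0r -v0; apply: mixed_set_vertex.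
  (* The second component kills the coefficients of the [T j], the first one that of [(1, 0)], and
     the zero sum that of the origin. *)
  move: ce; rewrite big_ord_recl r0; under eq_bigr do rewrite rS.
  move=> ce; have cSS j : c (lift ord0 (lift ord0 j)) = 0.
    apply: (free (fun i => c (lift ord0 i))).
    by move: ce => /(congr1 (fun p => p.2)) /=; rewrite scaler0 add0r.
  have cz : c ord0 = 0.
    move: ce; rewrite big_ord_recl q0 scaler0 add0r big1 ?addr0.
      by move=> /(congr1 (fun p => p.1)) /=; rewrite /GRing.scale /= mulr1.
    by move=> j _; rewrite cSS scale0r.
  have cS : forall j, c (lift ord0 j) = 0.
    by apply: cons0 => //; move: c0; rewrite big_ord_recl cz add0r.
  exact: cons0.
- by move=> p _; apply: not_affinely_independent.
- exists q; split=> [i|c c0 ce]; last first.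
    by apply: cons0 => //; apply: free; rewrite ce.
  split=> //=; rewrite /q; case: unliftP => [j _|_] /=.
    by rewrite sum_lepi_indicator Ttight.
  by rewrite big1 // => j _; rewrite mxE mulr0.
move=> p pF; apply: (@not_affinely_independent_graph _ _
  (\row_i (lift_coef f a N d i + b 0 i))) => i.
have [_ /= <-] := pF i; rewrite sum_lepi_coef.
by apply: eq_bigr => j _; rewrite mxE.
Qed.

End Blocks.

(** * From the partition to block labels, and the final statement *)

Lemma consecutive_partition_block (n t : nat) (N : 'I_t -> {set 'I_n}) :
  consecutive_partition N ->
  exists blk : 'I_n -> 'I_t, forall i k, (i \in N k) = (blk i == k).
Proof.
move=> [injN /and3P[/eqP cov /finset.trivIsetP triv _] _].
have /choice[blk blkP] : forall i, exists k, i \in N k.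
  move=> i; have : i \in [set: 'I_n] by rewrite inE.
  by rewrite -cov => /finset.bigcupP[_ /imsetP[k _ ->] ik]; exists k.
exists blk => i k; apply/idP/eqP => [ik|<- //].
apply: contraTeq ik => ne.
(* Disjointness is stated for distinct sets; injectivity of [N] yields it for distinct labels. *)
have /pred0P/(_ i) := triv (N (blk i)) (N k) (imset_f _ (finset.in_setT _))
  (imset_f _ (finset.in_setT _)) (contra_neq (@injN _ _) ne).
by rewrite /= blkP /= => ->.
Qed.

Theorem corollary6p4 (R : realType) (n t : nat) (f : R -> R)
    (a b : 'rV[R]_n) (N : 'I_t -> {set 'I_n})
    (n_gt0 : (0 < n)%N) (t_gt0 : (0 < t)%N)
    (f_concave : concave f) (f0 : f 0 = 0)
    (a_ge0 : forall i, 0 <= a 0 i)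
    (N_part : consecutive_partition N)
    (a_asc : forall (k : 'I_t) (i j : 'I_n), i \in N k -> j \in N k ->
       (i <= j)%N -> a 0 i <= a 0 j) :
  (forall d : 'S_n,
     facet_defining (convex_hull (mixed_set f a b N))
       (fun p => \sum_(j < n) lepi_coef f a b N d j * p.2 0 (d j))
       (fun p => p.1)
     /\ forall j : 'I_n, epi_coef f a b d j <= lepi_coef f a b N d j)
  /\
  convex_hull (mixed_set f a b N) =
    [set p : R^o * 'rV[R]_n |
      [/\ forall d : 'S_n,
            \sum_(j < n) lepi_coef f a b N d j * p.2 0 (d j) <= p.1,
          forall i : 'I_n, 0 <= p.2 0 i <= 1
        & forall k : 'I_t, \sum_(i in N k) p.2 0 i <= 1]]%classic.
Proof.
have [blk blkE] := consecutive_partition_block N_part.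
have asc i l : blk i = blk l -> (i <= l)%N -> a 0 i <= a 0 l.
  by move=> e; apply: (a_asc (blk i)); rewrite blkE ?e.
split; last exact: hull_eq_polyhedron.
move=> d; split; first exact: facet_defining_lepi.
by move=> j; rewrite lerD2r (epi_le_lift blkE).
Qed.
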